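(* Let $(A,\cdot,\bullet)$ be a two-sided skew brace with associative $\star$-product. Let $D:=[A^{\cdot},A^{\cdot}]$, let $R:=A/D$ be the associated radical ring, and let $\pi:A\to R$ be the quotient map. For every $n\geq 1$ there is a short exact sequence of groups \[1\longrightarrow P_n(A)\cap D\longrightarrow P_n(A)\overset{\pi}{\longrightarrow}R^n\longrightarrow 1,\qquad(\ast)\] where $P_n(A)$ is regarded as a subgroup of $A^{\cdot}$ and $R^n$ as an additive group. Moreover, $P_n(A)$ is an ideal of $A$ and, for $n\geq 2$, the operations $x+y:=x\cdot y$, $xy:=x\star y$ make $P_n(A)$ into a radical ring, and $(\ast)$ is a short exact sequence of rings, where $R^n$ carries the ring structure induced from $R$. The kernel $P_n(A)\cap D$ is annihilated on both sides by $A$ under $\star$ (i.e. $a\star x=x\star a=1$ for all $a\in A$, $x\in P_n(A)\cap D$); in particular, it has zero multiplication.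
   Context: A skew brace is a triple $(A,\cdot,\bullet)$ where $A^{\cdot}=(A,\cdot)$ and $A^{\bullet}=(A,\bullet)$ are groups with the same identity $1$ such that $a\bullet(b\cdot c)=(a\bullet b)\cdot a^{-1}\cdot(a\bullet c)$ for all $a,b,c\in A$, where $a^{-1}$ is the inverse in $A^{\cdot}$. It is two-sided if in addition $(a\cdot b)\bullet c=(a\bullet c)\cdot c^{-1}\cdot(b\bullet c)$ for all $a,b,c$. Put $\lambda_a(b):=a^{-1}\cdot(a\bullet b)$ and $a\star b:=a^{-1}\cdot(a\bullet b)\cdot b^{-1}$. An ideal of $A$ is a subset that is a normal subgroup of both $A^{\cdot}$ and $A^{\bullet}$ and is mapped into itself by every $\lambda_a$. For associative $\star$, set $P_1(A):=A$ and, for $n\geq 2$, let $P_n(A)$ be the subgroup of $A^{\cdot}$ generated by all products $a_1\star\cdots\star a_n$ with $a_i\in A$. A radical ring is a ring without identity $(S,+,\cdot)$ (associative, not assumed unital) such that for every $x\in S$ there is $y\in S$ with $x+y+xy=0$. $D=[A^{\cdot},A^{\cdot}]$ is the commutator subgroup of $A^{\cdot}$; under the stated hypotheses $R=A/D$ is a radical ring with (well-defined) operations $(aD)+(bD):=(a\cdot b)D$ and $(aD)(bD):=(a\star b)D$. $R^n$ is the additive subgroup of $R$ generated by all products of $n$ elements of $R$ ($R^1=R$). *)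

(* Defs.v *)
From HB Require Import structures.
From mathcomp Require Import all_boot ssralg.
From mathcomp Require Import boolp classical_sets functions.

Set Implicit Arguments.
Unset Strict Implicit.
Unset Printing Implicit Defensive.

Local Open Scope classical_set_scope.
Local Open Scope quotient_scope.
Local Open Scope group_scope.

(* Groups and non-unital rings carried by a subset of a type.  MathComp has no
   structure for rings without identity, and the groups and rings below (P_n(A),
   its intersection with D, R^n) are all given by subsets of A or of R.  The
   operations are total functions on T, but the axioms only concern the
   elements of the carrier. *)

Record opgroup (T : Type) := OpGroup {
  gset : set T; gop : T -> T -> T; gone : T; ginv : T -> T }.

Record opring (T : Type) := OpRing {
  rgroup :> opgroup T; rmul : T -> T -> T }.

Section OpStructures.
Variable T : Type.

Record is_group (G : opgroup T) : Prop := IsGroup {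
  gopS : forall x y, gset G x -> gset G y -> gset G (gop G x y);
  goneS : gset G (gone G);
  ginvS : forall x, gset G x -> gset G (ginv G x);
  gopA : forall x y z, gset G x -> gset G y -> gset G z ->
    gop G x (gop G y z) = gop G (gop G x y) z;
  gop1l : forall x, gset G x -> gop G (gone G) x = x;
  gop1r : forall x, gset G x -> gop G x (gone G) = x;
  gopVl : forall x, gset G x -> gop G (ginv G x) x = gone G;
  gopVr : forall x, gset G x -> gop G x (ginv G x) = gone G }.

Record is_ring (S : opring T) : Prop := IsRing {
  ring_group : is_group S;
  ring_addC : forall x y, gset S x -> gset S y -> gop S x y = gop S y x;
  ring_mulS : forall x y, gset S x -> gset S y -> gset S (rmul S x y);
  ring_mulA : forall x y z, gset S x -> gset S y -> gset S z ->
    rmul S x (rmul S y z) = rmul S (rmul S x y) z;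
  ring_mulDl : forall x y z, gset S x -> gset S y -> gset S z ->
    rmul S (gop S x y) z = gop S (rmul S x z) (rmul S y z);
  ring_mulDr : forall x y z, gset S x -> gset S y -> gset S z ->
    rmul S x (gop S y z) = gop S (rmul S x y) (rmul S x z) }.

Definition is_radical_ring (S : opring T) : Prop :=
  is_ring S /\
  forall x, gset S x ->
    exists2 y, gset S y & gop S (gop S x y) (rmul S x y) = gone S.

Definition sub_group (G : opgroup T) (H : set T) : opgroup T :=
  OpGroup H (gop G) (gone G) (ginv G).

Definition sub_ring (S : opring T) (H : set T) : opring T :=
  OpRing (sub_group S H) (rmul S).

Definition subgroup (G : opgroup T) (H : set T) : Prop :=
  H `<=` gset G /\ is_group (sub_group G H).

Definition normal_subgroup (G : opgroup T) (N : set T) : Prop :=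
  subgroup G N /\
  forall g x, gset G g -> N x -> N (gop G (gop G g x) (ginv G g)).

Definition generated (G : opgroup T) (X : set T) : set T :=
  smallest (subgroup G) X.

(* The products of n elements, bracketed to the left (for n >= 1). *)
Definition nfold_products (op : T -> T -> T) (n : nat) : set T :=
  [set x | exists a (s : n.-1.-tuple T), x = foldl op a s].

End OpStructures.

Section Morphisms.
Variables T1 T2 : Type.

Definition is_group_hom (G : opgroup T1) (H : opgroup T2) (f : T1 -> T2) :=
  set_fun (gset G) (gset H) f /\
  forall x y, gset G x -> gset G y -> f (gop G x y) = gop H (f x) (f y).

Definition is_ring_hom (S : opring T1) (S' : opring T2) (f : T1 -> T2) :=
  is_group_hom S S' f /\
  forall x y, gset S x -> gset S y -> f (rmul S x y) = rmul S' (f x) (f y).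

End Morphisms.

Section ShortExact.
Variables T1 T2 T3 : Type.

(* 1 --> K --i--> G --p--> Q --> 1 *)
Definition group_short_exact (K : opgroup T1) (G : opgroup T2) (Q : opgroup T3)
    (i : T1 -> T2) (p : T2 -> T3) : Prop :=
  [/\ [/\ is_group K, is_group G & is_group Q],
      is_group_hom K G i /\ is_group_hom G Q p,
      set_inj (gset K) i,
      i @` gset K = gset G `&` p @^-1` [set gone Q]
    & set_surj (gset G) (gset Q) p].

Definition ring_short_exact (K : opring T1) (S : opring T2) (Q : opring T3)
    (i : T1 -> T2) (p : T2 -> T3) : Prop :=
  [/\ [/\ is_ring K, is_ring S & is_ring Q],
      is_ring_hom K S i /\ is_ring_hom S Q p
    & group_short_exact K S Q i p].

End ShortExact.

Definition dot_group (G : groupType) : opgroup G :=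
  OpGroup setT *%g 1 (@monoid.inv G).

Definition add_group (V : zmodType) : opgroup V :=
  OpGroup setT +%R 0%R (@GRing.opp V).

Section Abelianization.
Variable G : groupType.
Implicit Types x y z : G.

Definition derived : set G :=
  generated (dot_group G) [set z | exists x y, z = [~ x, y]].

Lemma subgroup_dotP (H : set G) :
  H 1 -> (forall x y, H x -> H y -> H (x * y)) -> (forall x, H x -> H x^-1) ->
  subgroup (dot_group G) H.
Proof.
move=> H1 HM HV; split=> //; split=> //= *.
- exact: mulgA.
- exact: mul1g.
- exact: mulg1.
- exact: mulVg.
- exact: mulgV.
Qed.

Lemma derived1 : derived 1.
Proof. by move=> H [[_ gH] _]; exact: (goneS gH). Qed.

Lemma derivedM x y : derived x -> derived y -> derived (x * y).
Proof.
move=> Dx Dy H HH; have [[_ gH] _] := HH.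
exact: (gopS gH) (Dx _ HH) (Dy _ HH).
Qed.

Lemma derivedV x : derived x -> derived x^-1.
Proof. by move=> Dx H HH; have [[_ gH] _] := HH; exact: (ginvS gH) (Dx _ HH). Qed.

Lemma derivedR x y : derived [~ x, y].
Proof. by move=> H [_]; apply; exists x, y. Qed.

Lemma derivedJ x y : derived x -> derived (x ^ y).
Proof.
move=> Dx; rewrite -[x ^ y](mulVKg x) -commgEl.
exact: derivedM Dx (derivedR _ _).
Qed.

(* Equality of cosets: xD = yD. *)
Definition congD x y : bool := `[< derived (x^-1 * y) >].

Lemma congD_refl : reflexive congD.
Proof. by move=> x; apply/asboolP; rewrite mulVg; exact: derived1. Qed.

Lemma congD_sym : symmetric congD.
Proof.
by move=> x y; apply/asboolP/asboolP => /derivedV; rewrite invgM invgK.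
Qed.

Lemma congD_trans : transitive congD.
Proof.
move=> y x z /asboolP xy /asboolP yz; apply/asboolP.
by rewrite -(mulVKg y z) mulgA; exact: derivedM.
Qed.

Canonical congD_equiv := EquivRel congD congD_refl congD_sym congD_trans.

Definition abelianization := {eq_quot congD}.

HB.instance Definition _ := Choice.on abelianization.
HB.instance Definition _ := Quotient.on abelianization.

Definition pi_ab : G -> abelianization := \pi_abelianization.

Lemma pi_abP x y : pi_ab x = pi_ab y <-> derived (x^-1 * y).
Proof.
split=> [/eqmodP/asboolP //|Dxy]; exact/eqmodP/asboolP.
Qed.

Lemma pi_ab_surj (u : abelianization) : exists x, pi_ab x = u.
Proof. by exists (repr u); exact: reprK. Qed.

Definition ab_zero : abelianization := pi_ab 1.
Definition ab_opp (u : abelianization) : abelianization :=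
  pi_ab (repr u)^-1.
Definition ab_add (u v : abelianization) : abelianization :=
  pi_ab (repr u * repr v).

Lemma pi_ab_add x y : pi_ab (x * y) = ab_add (pi_ab x) (pi_ab y).
Proof.
apply/pi_abP; have /pi_abP Dx := esym (reprK (pi_ab x)).
have /pi_abP Dy := esym (reprK (pi_ab y)).
set x' := repr (pi_ab x) in Dx *; set y' := repr (pi_ab y) in Dy *.
have -> : (x * y)^-1 * (x' * y') = (x^-1 * x') ^ y * (y^-1 * y').
  by rewrite invgM conjgE !mulgA mulgK.
exact: derivedM (derivedJ y Dx) Dy.
Qed.

Lemma pi_ab_opp x : pi_ab x^-1 = ab_opp (pi_ab x).
Proof.
apply/pi_abP; have /pi_abP Dx := reprK (pi_ab x).
rewrite invgK; set x' := repr _ in Dx *.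
have -> : x * x'^-1 = (x'^-1 * x) ^ x'^-1.
  by rewrite conjgE invgK !mulgA mulgV mul1g.
exact: derivedJ.
Qed.

Fact ab_addA : associative ab_add.
Proof.
move=> u v w; have [x <-] := pi_ab_surj u; have [y <-] := pi_ab_surj v.
by have [z <-] := pi_ab_surj w; rewrite -!pi_ab_add mulgA.
Qed.

Fact ab_addC : commutative ab_add.
Proof.
move=> u v; have [x <-] := pi_ab_surj u; have [y <-] := pi_ab_surj v.
rewrite -!pi_ab_add; apply/pi_abP; rewrite invgM -mulgA.
exact: (derivedR y x).
Qed.

Fact ab_add0 : left_id ab_zero ab_add.
Proof. by move=> u; have [x <-] := pi_ab_surj u; rewrite -pi_ab_add mul1g. Qed.

Fact ab_addN : left_inverse ab_zero ab_opp ab_add.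
Proof.
move=> u; have [x <-] := pi_ab_surj u.
by rewrite -pi_ab_opp -pi_ab_add mulVg.
Qed.

HB.instance Definition _ :=
  GRing.isZmodule.Build abelianization ab_addA ab_addC ab_add0 ab_addN.

Lemma pi_abM x y : pi_ab (x * y) = (pi_ab x + pi_ab y)%R.
Proof. exact: pi_ab_add. Qed.

End Abelianization.

HB.mixin Record Group_isSkewBrace A of Group A := {
  circ : A -> A -> A;
  circ_inv : A -> A;
  circA : associative circ;
  circ1g : left_id 1 circ;
  circg1 : right_id 1 circ;
  circVg : left_inverse 1 circ_inv circ;
  circgV : right_inverse 1 circ_inv circ;
  circ_mulr : forall a b c : A,
    circ a (b * c) = circ a b * a^-1 * circ a c
}.

#[short(type="skewBraceType")]
HB.structure Definition SkewBrace := {A of Group_isSkewBrace A & Group A}.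

HB.mixin Record SkewBrace_isTwoSided A of SkewBrace A := {
  circ_mull : forall a b c : A,
    circ (a * b) c = circ a c * c^-1 * circ b c
}.

#[short(type="twoSidedSkewBraceType")]
HB.structure Definition TwoSidedSkewBrace :=
  {A of SkewBrace_isTwoSided A & SkewBrace A}.

Bind Scope group_scope with SkewBrace.sort.
Bind Scope group_scope with TwoSidedSkewBrace.sort.

Definition circ_group (A : skewBraceType) : opgroup A :=
  OpGroup setT (@circ A) 1 (@circ_inv A).

Definition lambda (A : skewBraceType) (a b : A) : A := a^-1 * circ a b.

Definition star (A : skewBraceType) (a b : A) : A := a^-1 * circ a b * b^-1.

Definition ideal (A : skewBraceType) (I : set A) : Prop :=
  [/\ normal_subgroup (dot_group A) I,
      normal_subgroup (circ_group A) I
    & forall a x, I x -> I (lambda a x)].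

(* P n is P_n(A) for n >= 1; P 0 has no meaning. *)
Definition P (A : skewBraceType) (n : nat) : set A :=
  if (n <= 1)%N then setT
  else generated (dot_group A) (nfold_products (@star A) n).
Arguments P : clear implicits.

(* The operations x + y := x * y and xy := star x y on A; not a ring in
   general, as the group A need not be abelian. *)
Definition dot_star (A : skewBraceType) : opring A :=
  OpRing (dot_group A) (@star A).

(* The product (aD)(bD) := (a star b)D of A/D, computed on representatives;
   it is well defined by quo_mul_pi. *)
Definition quo_mul (A : skewBraceType) (u v : abelianization A) :
    abelianization A :=
  pi_ab (star (repr u) (repr v)).

Definition quo_ring (A : skewBraceType) : opring (abelianization A) :=
  OpRing (add_group (abelianization A)) (@quo_mul A).

(* R^n for R = A/D and n >= 1; R^0 has no meaning. *)
Definition quo_power (A : skewBraceType) (n : nat) : set (abelianization A) :=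
  if (n <= 1)%N then setT
  else generated (add_group (abelianization A)) (nfold_products (@quo_mul A) n).
Arguments quo_power : clear implicits.

Section QuotientRing.
Variable A : twoSidedSkewBraceType.
Implicit Types a b c d : A.

Lemma starMr a b c : star a (b * c) = star a b * (b * star a c * b^-1).
Proof. by rewrite /star circ_mulr invgM !mulgA mulgVK. Qed.

Lemma starMl a b c : star (a * b) c = b^-1 * star a c * b * star b c.
Proof. by rewrite /star circ_mull invgM !mulgA mulgK. Qed.

Lemma pi_abV a : pi_ab a^-1 = (- pi_ab a)%R.
Proof. exact: pi_ab_opp. Qed.

Lemma pi_starMr a b c :
  pi_ab (star a (b * c)) = (pi_ab (star a b) + pi_ab (star a c))%R.
Proof.
rewrite starMr; move: (star a b) (star a c) => u v.
by rewrite !pi_abM pi_abV [(pi_ab b + _)%R]GRing.addrC GRing.addrK.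
Qed.

Lemma pi_starMl a b c :
  pi_ab (star (a * b) c) = (pi_ab (star a c) + pi_ab (star b c))%R.
Proof.
rewrite starMl; move: (star a c) (star b c) => u v.
by rewrite !pi_abM pi_abV [(- _ + _)%R]GRing.addrC GRing.addrNK.
Qed.

Lemma derived_hom0 (V : zmodType) (f : A -> V) :
  (forall a b, f (a * b) = (f a + f b)%R) -> forall d, derived d -> f d = 0%R.
Proof.
move=> fM.
have f1 : f 1 = 0%R by apply: (@GRing.addrI _ (f 1)); rewrite -fM mulg1 GRing.addr0.
have fV a : f a^-1 = (- f a)%R.
  by apply: (@GRing.addrI _ (f a)); rewrite -fM mulgV f1 GRing.subrr.
move=> d Dd; apply: (Dd [set x | f x = 0%R]); split; last first.
  move=> _ [a [b ->]] /=; rewrite /commg /conjg !fM !fV.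
  by rewrite [(f a + f b)%R]GRing.addrC GRing.addKr GRing.addNr.
apply: subgroup_dotP => //= a; first by move=> b; rewrite fM => -> ->; rewrite GRing.addr0.
by rewrite fV => ->; rewrite GRing.oppr0.
Qed.

Lemma pi_star_eq a a' b b' : pi_ab a = pi_ab a' -> pi_ab b = pi_ab b' ->
  pi_ab (star a b) = pi_ab (star a' b').
Proof.
move=> /pi_abP Da /pi_abP Db.
rewrite -(mulVKg a a') -(mulVKg b b').
move: (a^-1 * a') (b^-1 * b') Da Db => d e Da Db.
rewrite pi_starMl !pi_starMr.
have Dd c : pi_ab (star d c) = 0%R.
  exact: (derived_hom0 (fun x y => pi_starMl x y c) Da).
have De c : pi_ab (star c e) = 0%R.
  exact: (derived_hom0 (fun x y => pi_starMr c x y) Db).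
by rewrite De !Dd !GRing.addr0.
Qed.

Lemma quo_mul_pi a b : quo_mul (pi_ab a) (pi_ab b) = pi_ab (star a b).
Proof. by apply: pi_star_eq; exact: reprK. Qed.

Lemma quo_ring_radical : associative (@star A) -> is_radical_ring (quo_ring A).
Proof.
move=> starA; split=> [|u _] /=.
  split=> //=; first split=> //=.
  - by move=> *; exact: GRing.addrA.
  - by move=> *; exact: GRing.add0r.
  - by move=> *; exact: GRing.addr0.
  - by move=> *; exact: GRing.addNr.
  - by move=> *; exact: GRing.subrr.
  - by move=> *; exact: GRing.addrC.
  - move=> u v w _ _ _; have [a <-] := pi_ab_surj u.
    have [b <-] := pi_ab_surj v; have [c <-] := pi_ab_surj w.
    by rewrite (quo_mul_pi b) (quo_mul_pi a) (quo_mul_pi a) (quo_mul_pi _ c) starA.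
  - move=> u v w _ _ _; have [a <-] := pi_ab_surj u.
    have [b <-] := pi_ab_surj v; have [c <-] := pi_ab_surj w.
    by rewrite -pi_abM (quo_mul_pi _ c) (quo_mul_pi a) (quo_mul_pi b) pi_starMl.
  - move=> u v w _ _ _; have [a <-] := pi_ab_surj u.
    have [b <-] := pi_ab_surj v; have [c <-] := pi_ab_surj w.
    by rewrite -pi_abM (quo_mul_pi a) (quo_mul_pi a) (quo_mul_pi a) pi_starMr.
have [a <-] := pi_ab_surj u; exists (pi_ab (circ_inv a)) => //.
rewrite quo_mul_pi /star circgV mulg1 !pi_abM !pi_abV.
by rewrite GRing.addrACA !GRing.subrr GRing.addr0.
Qed.

End QuotientRing.

(* Main.v *)
From HB Require Import structures.
Require Import Defs.
From mathcomp Require Import all_boot ssralg.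
From mathcomp Require Import boolp classical_sets functions.

(** The statement reduces to one fact: if [star] is associative, every value
    [star a b] is central in the group [A] (lemma [star_central]).  Then
    [star] is multiplicative in each argument ([star_mulr], [star_mull]), so it
    kills commutators, and the derived subgroup is annihilated on both sides
    ([star_derived]).  For [n >= 2] the group [P A n] lies in the centre of [A]
    and absorbs [star] on both sides; hence it is an ideal, and a ring in which
    the inverse for [circ] is the quasi-inverse.  The projection to
    [abelianization A] carries [n]-fold products to [n]-fold products, which
    gives its image on [P A n], and its kernel there is [P A n] intersected with
    the derived subgroup.

    Centrality is proved as follows.  Let [C] be the centralizer of the
    conjugates of all values of [star].
    - Expanding [star (a * b) (c * d)] in the two possible orders shows that,
      modulo [C], [star b c] is the twisted commutator [b^-1 * c * b * c^-1]
      ([to_conj_star]).  So this commutator is associative on the quotient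
      [A / C], and a theorem of Levi ([wcommA_class2]) makes [A / C] nilpotent
      of class at most two.  Triple products therefore lie in [C].
    - With this, associativity on the triple [(a * b, c, d)] forces any two
      values of [star] to commute ([star_commute]).
    - Next, associativity on [(a, u * c, d)] with [u] a value of [star] shows
      that fourfold products are central ([star4_central]).
    - Associativity of [circ] makes [b] commute with
      [star a c * star (star a b) c] ([commute_star_mul]).  Replacing [c] by
      [star b c] turns the second factor into a fourfold product, so [b]
      commutes with [star a (star b c)], and then with [star a c]. *)

Set Implicit Arguments.
Unset Strict Implicit.
Unset Printing Implicit Defensive.

Local Open Scope classical_set_scope.
Local Open Scope quotient_scope.
Local Open Scope group_scope.

(** * Groups whose twisted commutator is associative *)

Lemma commute_conj (G : groupType) (x y : G) : commute x y <-> x ^ y = x.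
Proof.
rewrite /commute conjgE; split=> [->|xy]; first by rewrite mulKg.
by rewrite -{2}xy mulVKg.
Qed.

(** Modulo the centralizer of the [star] values, [star a b] becomes
    [a^-1 * b * a * b^-1]; this sign convention is forced by that. *)
Definition wcomm (G : groupType) (a b : G) : G := [~ a, b^-1].

Lemma Hall_Witt (G : groupType) (x y z : G) :
  [~ x, y^-1, z] ^ y * [~ y, z^-1, x] ^ z * [~ z, x^-1, y] ^ x = 1.
Proof.
rewrite /commg !conjgE; do ![rewrite !invgM | rewrite !invgK].
rewrite !mulgA.
by do ![rewrite !mulgK | rewrite !mulgVK | rewrite mulVg | rewrite mulgV].
Qed.

Section Levi.
Variable G : groupType.
Implicit Types a b c : G.
Local Notation wc := (@wcomm G).

Lemma wcommE a b : wc a b = a^-1 * b * a * b^-1.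
Proof. by rewrite /wcomm commgEl conjgE invgK !mulgA. Qed.

Lemma wcomm_eq1 a b : wc a b = 1 <-> a * b = b * a.
Proof.
rewrite wcommE; split=> [/eqP|ab].
  rewrite mulg_eq1 invgK -mulgA -[_ * _ == _](inj_eq (mulgI a)) mulVKg eq_sym.
  by move/eqP.
by rewrite -!mulgA (mulgA b) -ab mulgK mulVg.
Qed.

Lemma wcomm_id a : wc a a = 1.
Proof. exact/wcomm_eq1. Qed.

Lemma wcomm1g a : wc 1 a = 1.
Proof. by rewrite /wcomm comm1g. Qed.

Lemma wcommg1 a : wc a 1 = 1.
Proof. by rewrite /wcomm invg1 commg1. Qed.

Hypothesis wcA : associative wc.

(** [wc a (wc a b) = wc (wc a a) b = 1]. *)
Lemma wcomm_commutel a b : commute a (wc a b).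
Proof. by apply/wcomm_eq1; rewrite wcA wcomm_id wcomm1g. Qed.

Lemma wcomm_commuter a b : commute (wc a b) b.
Proof. by apply/wcomm_eq1; rewrite -wcA wcomm_id wcommg1. Qed.

(** The element [z = wc a b] commutes with [a] and [b], so [b * a = z * a * b]
    can be solved for [a * b]. *)
Lemma wcommC a b : wc b a = (wc a b)^-1.
Proof.
have := wcomm_commutel a b; have := wcomm_commuter a b.
have ab : b * a = a * wc a b * b by rewrite wcommE !mulgA mulgV mul1g mulgVK.
rewrite [wc b a]wcommE -[b^-1 * a * b]mulgA; move: (wc a b) ab => z ab zb za.
have {ab} -> : a * b = b * (a * z^-1).
  apply: (mulIg z); rewrite !mulgA mulgVK ab -!mulgA; congr (_ * _).
  by rewrite zb.
by rewrite mulKg; apply/eqP; rewrite -(inj_eq (mulIg a)) mulgVK (commuteV za).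
Qed.

Lemma wcommVl a b : wc a^-1 b = (wc a b)^-1.
Proof.
have := wcomm_commutel a b; have ab : b * a * b^-1 = a * wc a b.
  by rewrite wcommE !mulgA mulgV mul1g.
rewrite [LHS]wcommE invgK; move: (wc a b) ab => z ab az.
have -> : a * b * a^-1 * b^-1 = a * (b * a * b^-1)^-1.
  by rewrite !invgM invgK !mulgA.
by rewrite ab (_ : a * z = z * a) // invgM mulVKg.
Qed.

(** For the middle variable: [a] commutes with [wc a b], so conjugates of an
    element always commute, and [wc a b] is a product of conjugates of [b] and
    [b^-1]. *)
Lemma commute_wcomm3 a b c :
  [/\ commute (wc (wc a b) c) a, commute (wc (wc a b) c) b
    & commute (wc (wc a b) c) c].
Proof.
split; last exact: wcomm_commuter.
  by rewrite -wcA; apply/commute_sym/wcomm_commutel.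
have conj (x y : G) : commute x (x ^ y).
  have -> : x ^ y = x * wc x y^-1.
    by rewrite wcommE invgK conjgE !mulgA mulgV mul1g.
  exact: commuteM (commute_refl _) (wcomm_commutel _ _).
apply: commute_sym.
rewrite [wc (wc a b) c]commgEl; apply: commuteM.
  exact/commuteV/commute_sym/wcomm_commuter.
have -> : wc a b = b ^ a * b^-1 by rewrite wcommE conjgE !mulgA.
rewrite conjMg -conjgM conjVg.
apply: commuteM; [exact: conj | exact/commuteV/conj].
Qed.

(** Levi's theorem.  Associativity together with anticommutativity [wcommC]
    inverts a triple commutator [t a b c] when its arguments are rotated, and
    three rotations give [t a b c = (t a b c)^-1].  As [t] commutes with its
    arguments, the Hall-Witt identity reads [(t a b c)^-3 = 1]. *)
Lemma wcommA_class2 a b c : wc (wc a b) c = 1.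
Proof.
set t := fun x y z => wc (wc x y) z.
have rot (x y z : G) : t y z x = (t x y z)^-1 by rewrite /t wcommC wcA.
have tV : t a b c = (t a b c)^-1.
  by rewrite {1}(rot c a b) (rot b c a) (rot a b c) invgK.
have hw (x y z : G) : [~ x, y^-1, z] ^ y = (t x y z)^-1.
  have [_ ty _] := commute_wcomm3 x y z.
  have -> : [~ x, y^-1, z] = (t x y z)^-1.
    rewrite -[z in LHS]invgK -/(wc (wc x y) z^-1) -wcommC wcommC wcommVl invgK.
    by rewrite wcommC.
  exact/commute_conj/commute_sym/commuteV/commute_sym.
have := Hall_Witt a b c; rewrite !hw (rot a b c) (rot b c a) (rot a b c) -!tV.
by rewrite {1}tV mulVg mul1g.
Qed.
End Levi.

(** * The quotient by the centralizer of a normal closure *)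

Section ConjQuotient.
Variables (G : groupType) (X : set G).
Implicit Types x y z : G.

(** Two elements are identified when they act in the same way by conjugation on
    the normal closure of [X].  Quantifying over [g] makes this a congruence
    without any hypothesis on [X]. *)
Definition same_conj x y : bool :=
  `[< forall g s, X s -> s ^ (g * x) = s ^ (g * y) >].

Lemma same_conj_refl : reflexive same_conj.
Proof. by move=> x; apply/asboolP. Qed.

Lemma same_conj_sym : symmetric same_conj.
Proof. by move=> x y; apply/asboolP/asboolP => xy g s /xy. Qed.

Lemma same_conj_trans : transitive same_conj.
Proof.
move=> y x z /asboolP xy /asboolP yz; apply/asboolP => g s Xs.
by rewrite xy ?yz.
Qed.

Canonical same_conj_equiv :=
  EquivRel same_conj same_conj_refl same_conj_sym same_conj_trans.

Definition conj_quotient := {eq_quot same_conj}.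
HB.instance Definition _ := Choice.on conj_quotient.
HB.instance Definition _ := Quotient.on conj_quotient.

Definition to_conj x : conj_quotient := \pi_conj_quotient x.

Lemma to_conjP x y :
  to_conj x = to_conj y <-> forall g s, X s -> s ^ (g * x) = s ^ (g * y).
Proof. by split=> [/eqmodP/asboolP|xy] //; exact/eqmodP/asboolP. Qed.

Lemma to_conj_repr (u : conj_quotient) : to_conj (repr u) = u.
Proof. exact: reprK. Qed.

Lemma to_conj_mul_congr x x' y y' :
  to_conj x = to_conj x' -> to_conj y = to_conj y' ->
  to_conj (x * y) = to_conj (x' * y').
Proof.
move=> /to_conjP xx' /to_conjP yy'; apply/to_conjP => g s Xs.
by rewrite !mulgA yy' // conjgM xx' // -conjgM.
Qed.

Lemma to_conj_inv_congr x x' :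
  to_conj x = to_conj x' -> to_conj x^-1 = to_conj x'^-1.
Proof.
move=> /to_conjP xx'; apply/to_conjP => g s Xs.
rewrite [RHS]conjgM (_ : s ^ g = s ^ (g * x^-1 * x')); last first.
  by rewrite -xx' // mulgVK.
by rewrite -conjgM mulgK.
Qed.

Let one : conj_quotient := to_conj 1.
Let mul (u v : conj_quotient) := to_conj (repr u * repr v).
Let inv (u : conj_quotient) := to_conj (repr u)^-1.

Let mulE x y : mul (to_conj x) (to_conj y) = to_conj (x * y).
Proof. by apply: to_conj_mul_congr; exact: to_conj_repr. Qed.

Let invE x : inv (to_conj x) = to_conj x^-1.
Proof. by apply: to_conj_inv_congr; exact: to_conj_repr. Qed.

Let mulA : associative mul.
Proof.
move=> u v w; rewrite -[u]to_conj_repr -[v]to_conj_repr -[w]to_conj_repr.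
by rewrite !mulE mulgA.
Qed.

Let mul1 : left_id one mul.
Proof. by move=> u; rewrite -[u]to_conj_repr mulE mul1g. Qed.

Let mulr1 : right_id one mul.
Proof. by move=> u; rewrite -[u]to_conj_repr mulE mulg1. Qed.

Let mulV : left_inverse one inv mul.
Proof. by move=> u; rewrite -[u]to_conj_repr invE mulE mulVg. Qed.

Let mulrV : right_inverse one inv mul.
Proof. by move=> u; rewrite -[u]to_conj_repr invE mulE mulgV. Qed.

HB.instance Definition _ :=
  isGroup.Build conj_quotient mulA mul1 mulr1 mulV mulrV.

Let to_conjF : {morph to_conj : x y / x / y}.
Proof. by move=> x y; rewrite -mulE -invE. Qed.

HB.instance Definition _ :=
  isGroupMorphism.Build G conj_quotient to_conj to_conjF.
End ConjQuotient.

(** * Associative star operations have central values *)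

(** The operation [st] is abstract.  The rules [starMrJ] and [starMlJ] encode
    left and right distributivity of a two-sided skew brace, and [st_circl]
    encodes the associativity of its second group law. *)
Section StarCalculus.
Variables (A : groupType) (st : A -> A -> A).
Implicit Types a b c d g s w x y : A.
Hypothesis starMrJ : forall a b c, st a (b * c) = st a b * st a c ^ b^-1.
Hypothesis starMlJ : forall a b c, st (a * b) c = st a c ^ b * st b c.

Lemma star1g a : st 1 a = 1.
Proof.
apply: (mulgI (st 1 a)); rewrite mulg1 -[RHS](congr1 (st^~ a) (mulg1 1)).
by rewrite starMlJ conjg1.
Qed.

Lemma starg1 a : st a 1 = 1.
Proof.
apply: (mulgI (st a 1)); rewrite mulg1 -[RHS](congr1 (st a) (mulg1 1)).
by rewrite starMrJ invg1 conjg1.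
Qed.

Lemma starVlJ a b : st a b = (st a^-1 b ^ a)^-1.
Proof. by symmetry; apply: mulg1_eq; rewrite -starMlJ mulVg star1g. Qed.

Lemma starVrJ a b : st a b^-1 = (st a b ^ b)^-1.
Proof.
symmetry; apply: mulg1_eq; apply: (conjg_inj b^-1).
by rewrite conjMg conjgK -starMrJ mulgV starg1 conj1g.
Qed.

(** Whatever centralizes or commutes with all values of [st] therefore does so
    for their conjugates as well. *)
Lemma star_conj a b g : st a b ^ g = (st a g^-1)^-1 * st a (g^-1 * b).
Proof. by rewrite starMrJ invgK mulKg. Qed.

(** Comparison of the two expansions of [st (a * b) (c * d)]. *)
Lemma star_twist a b c d :
  st a d ^ (c^-1 * b * st b c * c * b^-1) = st a d.
Proof.
have : st a d ^ (c^-1 * b) * st b c = st b c * st a d ^ (b * c^-1).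
  apply: (mulgI (st a c ^ b)); apply: (mulIg (st b d ^ c^-1)).
  transitivity (st (a * b) (c * d)).
    by rewrite starMlJ !starMrJ conjMg -conjgM !mulgA.
  by rewrite starMrJ !starMlJ conjMg -conjgM !mulgA.
move=> /(congr1 (fun x => (st b c)^-1 * x)); rewrite mulKg.
rewrite -conjgE -conjgM => /(congr1 (fun x => x ^ (c * b^-1))).
by rewrite -!conjgM !mulgA mulgVK mulgV conjg1.
Qed.

Definition star_values : set A := [set s | exists a b, s = st a b].

Local Notation q := (@to_conj A star_values).

Let qM x y : q (x * y) = q x * q y. Proof. exact: gmulfM. Qed.
Let qV x : q x^-1 = (q x)^-1. Proof. exact: gmulfV. Qed.
Let qJ x y : q (x ^ y) = q x ^ q y. Proof. exact: gmulfJ. Qed.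
Let q1 : q 1 = 1. Proof. exact: gmulf1. Qed.

(** By [star_twist] the element [c^-1 * b * st b c * c * b^-1] centralizes the
    values of [st] and hence their conjugates, so it is trivial in the
    quotient, where the relation is solved for [st b c]. *)
Lemma to_conj_star b c : q (st b c) = wcomm (q b) (q c).
Proof.
have : q (c^-1 * b * st b c * c * b^-1) = q 1.
  apply/to_conjP => g _ [a [d ->]]; rewrite mulg1 conjgM star_conj.
  by rewrite conjMg conjVg !star_twist.
rewrite q1 !qM !qV => /eqP; rewrite mulg_eq1 invgK wcommE => /eqP.
move: (q b) (q c) (q (st b c)) => u v w uvw.
by rewrite -{2}uvw !mulgA !mulgK mulVg mul1g.
Qed.

Lemma to_conj1_commute a b w : q w = 1 -> commute (st a b) w.
Proof.
rewrite -q1 => /to_conjP h; apply/commute_conj.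
by have := h 1 (st a b); rewrite !mul1g conjg1; apply; exists a, b.
Qed.

Hypothesis starA : associative st.

Lemma wcomm_conjA : associative (@wcomm (conj_quotient star_values)).
Proof.
move=> u v w; rewrite -[u]to_conj_repr -[v]to_conj_repr -[w]to_conj_repr.
move: (repr u) (repr v) (repr w) => a b c.
rewrite -(to_conj_star b c) -(to_conj_star a b) -(to_conj_star a).
by rewrite -(to_conj_star _ c) starA.
Qed.

Lemma to_conj_star3 a b c : q (st (st a b) c) = 1.
Proof. by rewrite !to_conj_star (wcommA_class2 wcomm_conjA). Qed.

(** Write [v = st a c], [e = st b d] and [f = st v d].  The two sides of
    [st (st (a * b^-1) c) d = st (a * b^-1) (st c d)] differ, up to conjugations
    that act trivially, by the factor [e ^ v * e^-1], which must be [1].  Using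
    [b^-1] makes an arbitrary value [e] of [st] appear. *)
Lemma star_commute a c b d : commute (st a c) (st b d).
Proof.
pose v := st a c; pose e := st b d; pose f := st v d.
pose s := st b^-1 c.
have vE : st (v ^ b^-1) d = (e ^ v * f * e^-1) ^ b^-1.
  (* [v ^ b^-1] is [b * (v * b^-1)] and [st b^-1 d] is a conjugate of [e^-1]. *)
  rewrite conjgE invgK starMlJ starMlJ -/f (starVlJ b^-1) invgK.
  by rewrite -conjVg conjgM -!conjMg mulgA.
have := starA (a * b^-1) c d.
rewrite (starMlJ a _ c) (starMlJ a) (starMlJ (_ ^ _)) (starA b^-1) (starA a).
rewrite -/v -/f -/s vE => /mulIg.
have qf : q f = 1 by exact: to_conj_star3.
have qev : q (e ^ v) = q e.
  rewrite qJ; apply/commute_conj/commute_sym/wcomm_eq1.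
  by rewrite -to_conj_star /e starA to_conj_star3.
have -> : e ^ v * f * e^-1 = e ^ v * e^-1 * f.
  rewrite -[LHS]mulgA -[RHS]mulgA; congr (_ * _).
  suff: commute f e^-1 by [].
  exact/commuteV/commute_sym/to_conj1_commute.
set u := e ^ v * e^-1 * f => h.
have us : (u ^ b^-1) ^ s = u ^ b^-1.
  apply/commute_conj/commute_sym/to_conj1_commute.
  have qu : q u = 1 by rewrite (qM _ f) qf (qM _ e^-1) qev qV mulgV mulg1.
  by rewrite qJ qu conj1g.
move: h; rewrite us => /conjg_inj/esym/eqP.
rewrite -[X in _ == X]mul1g (inj_eq (mulIg f)) mulg_eq1 invgK => /eqP ev.
exact/commute_sym/commute_conj.
Qed.

Lemma star_commuteJ a c b d g : commute (st a c) (st b d ^ g).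
Proof.
rewrite star_conj; apply: commuteM; last exact: star_commute.
exact/commuteV/star_commute.
Qed.

(** With [u = st x y] and [s = st u d], the values being pairwise commuting,
    [st a (st (u * c) d) = st (st a (u * c)) d] becomes
    [st a (s ^ c) = st a s], while [st a (s ^ c) = st a s ^ c]. *)
Lemma star4_central a x y d c : commute (st a (st (st x y) d)) c.
Proof.
pose u := st x y; pose s := st u d.
apply/commute_conj; rewrite -/u -/s.
have sJ : st a (s ^ c) = st a s ^ c.
  rewrite conjgE !starMrJ invgK starVrJ conjMg.
  rewrite (_ : st a c ^ s^-1 = st a c); last first.
    exact/commute_conj/commuteV/star_commute.
  rewrite (_ : commute (st a s ^ c) (st a c ^ c)) ?mulKg //.
  by rewrite /commute -!conjMg; congr (_ ^ _); exact: star_commute.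
have := starA a (u * c) d.
rewrite (starMlJ u c) (starMrJ a u) (starMrJ a (_ ^ _)) -/s.
rewrite (_ : st a c ^ u^-1 = st a c); last first.
  exact/commute_conj/commuteV/star_commute.
rewrite (starMlJ (st a u)) (_ : _ ^ st a c = st (st a u) d); last first.
  exact/commute_conj/star_commute.
rewrite (_ : _ ^ (s ^ c)^-1 = st a (st c d)); last first.
  exact/commute_conj/commuteV/star_commuteJ.
by rewrite (starA a c) -(starA a u) -/s sJ => /mulIg.
Qed.

Hypothesis st_circl : forall a b c,
  st (a * st a b * b) c = st a (st b c) * st b c * st a c.

(** Comparison of [st_circl] with the expansion of its left side: the elements
    [(st a c * st (st a b) c) ^ b] and [st a c * st (st a b) c] agree. *)
Lemma commute_star_mul a b c : commute b (st a c * st (st a b) c).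
Proof.
apply/commute_sym/commute_conj.
have := st_circl a b c; rewrite !starMlJ starA.
rewrite (_ : st a c ^ st a b = st a c); last first.
  exact/commute_conj/star_commute.
rewrite -(mulgA _ (st b c)) (star_commute b c a c) mulgA => /mulIg ->.
exact: star_commute.
Qed.

(** In [commute_star_mul a b (st b c)] the second factor is
    [st a (st (st b b) c)], which is central by [star4_central]. *)
Lemma star_central a c b : commute (st a c) b.
Proof.
have drop x y z : commute x (y * z) -> commute x z -> commute x y.
  by move=> xyz xz; rewrite -(mulgK z y); apply: commuteM xyz (commuteV xz).
apply/commute_sym/(drop _ _ _ (commute_star_mul a b c)).
rewrite -starA; apply: (drop _ _ _ (commute_star_mul a b (st b c))).
rewrite -starA (starA b b c); exact/commute_sym/star4_central.
Qed.

Lemma star_mulr a b c : st a (b * c) = st a b * st a c.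
Proof.
rewrite starMrJ (_ : _ ^ _ = st a c) //; exact/commute_conj/star_central.
Qed.

Lemma star_mull a b c : st (a * b) c = st a c * st b c.
Proof.
rewrite starMlJ (_ : _ ^ _ = st a c) //; exact/commute_conj/star_central.
Qed.

Lemma starVr a b : st a b^-1 = (st a b)^-1.
Proof. by symmetry; apply: mulg1_eq; rewrite -star_mulr mulgV starg1. Qed.

Lemma starVl a b : st a^-1 b = (st a b)^-1.
Proof. by symmetry; apply: mulg1_eq; rewrite -star_mull mulgV star1g. Qed.

(** Both [st a] and [st ^~ a] are homomorphisms to [A] with commuting values,
    so they kill commutators. *)
Lemma star_derived a x : derived x -> st a x = 1 /\ st x a = 1.
Proof.
move=> Dx; apply: (Dx [set x | st a x = 1 /\ st x a = 1]); split.
  apply: subgroup_dotP => /=; first by rewrite star1g starg1.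
    move=> y z [ay ya] [az za].
    by rewrite star_mulr star_mull ay ya az za mulg1.
  by move=> y [ay ya]; rewrite starVr starVl ay ya invg1.
move=> _ [y [z ->]] /=; split.
  apply: (mulgI (st a (z * y))); rewrite -star_mulr -commgC mulg1 !star_mulr.
  exact: star_commute.
apply: (mulgI (st (z * y) a)); rewrite -star_mull -commgC mulg1 !star_mull.
exact: star_commute.
Qed.

End StarCalculus.

(** * Subgroups and subrings carried by sets *)

Lemma generated_subgroup (T : Type) (G : opgroup T) (X : set T) :
  is_group G -> X `<=` gset G -> subgroup G (generated G X).
Proof.
move=> gG XG.
have sub : generated G X `<=` gset G.
  by move=> x; apply; split => //; split => //; case: G gG {XG} => S op e i [].
split=> //; split=> /=.
- move=> x y Gx Gy H HH; have [[_ gH] _] := HH.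
  exact: (gopS gH) (Gx _ HH) (Gy _ HH).
- by move=> H [[_ gH] _]; exact: (goneS gH).
- by move=> x Gx H HH; have [[_ gH] _] := HH; exact: (ginvS gH) (Gx _ HH).
- by move=> x y z /sub Gx /sub Gy /sub Gz; exact: (gopA gG).
- by move=> x /sub; exact: (gop1l gG).
- by move=> x /sub; exact: (gop1r gG).
- by move=> x /sub; exact: (gopVl gG).
- by move=> x /sub; exact: (gopVr gG).
Qed.

Lemma subgroupI (T : Type) (G : opgroup T) (H K : set T) :
  subgroup G H -> subgroup G K -> subgroup G (H `&` K).
Proof.
move=> [HG gH] [_ gK]; split; first by move=> x [/HG].
split=> /=.
- by move=> x y [Hx Kx] [Hy Ky]; split; [exact: (gopS gH) | exact: (gopS gK)].
- by split; [exact: (goneS gH) | exact: (goneS gK)].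
- by move=> x [Hx Kx]; split; [exact: (ginvS gH) | exact: (ginvS gK)].
- by move=> x y z [Hx _] [Hy _] [Hz _]; exact: (gopA gH).
- by move=> x [Hx _]; exact: (gop1l gH).
- by move=> x [Hx _]; exact: (gop1r gH).
- by move=> x [Hx _]; exact: (gopVl gH).
- by move=> x [Hx _]; exact: (gopVr gH).
Qed.

Lemma is_subring (T : Type) (S : opring T) (H : set T) :
  is_ring S -> subgroup S H ->
  (forall x y, H x -> H y -> H (rmul S x y)) -> is_ring (sub_ring S H).
Proof.
move=> [gS addC mulS mulA mulDl mulDr] [HS gH] HM; split=> //=.
- by move=> x y /HS Sx /HS; exact: addC.
- by move=> x y z /HS Sx /HS Sy /HS; exact: mulA.
- by move=> x y z /HS Sx /HS Sy /HS; exact: mulDl.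
- by move=> x y z /HS Sx /HS Sy /HS; exact: mulDr.
Qed.

Lemma is_group_dot (G : groupType) : is_group (dot_group G).
Proof. by case: (@subgroup_dotP G setT). Qed.

Lemma is_group_add (V : zmodType) : is_group (add_group V).
Proof.
split=> //= [x y z _ _ _|x _|x _|x _|x _].
- exact: GRing.addrA.
- exact: GRing.add0r.
- exact: GRing.addr0.
- exact: GRing.addNr.
- exact: GRing.subrr.
Qed.

Lemma subgroup_addP (V : zmodType) (H : set V) :
  H 0%R -> (forall x y, H x -> H y -> H (x + y)%R) ->
  (forall x, H x -> H (- x)%R) -> subgroup (add_group V) H.
Proof.
move=> H0 HD HN; case: (is_group_add V) => _ _ _ addA add0 addr0 addN addrN.
by split=> //; split=> //= *; [exact: addA | exact: add0 | exact: addr0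
  | exact: addN | exact: addrN].
Qed.

(** The last factor is singled out because a product bracketed to the left is
    [op] of something with its last factor; this shows that it is central and
    lets it absorb a factor on the right. *)
Lemma nfold_seqP (T : Type) (op : T -> T -> T) (m : nat) (x : T) :
  nfold_products op m.+2 x <->
  exists a b s, size s = m /\ x = foldl op a (rcons s b).
Proof.
split=> [[a [t ->]]|[a [b [s [sm ->]]]]]; last first.
  have st : size (rcons s b) == m.+1 by rewrite size_rcons sm.
  by exists a, (Tuple st).
case: t => s /= ss; case/lastP: s ss => // s b.
rewrite size_rcons eqSS => /eqP ss.
by exists a, b, s.
Qed.

(** * Ideals of skew braces *)

Lemma circE (A : skewBraceType) (a b : A) : circ a b = a * star a b * b.
Proof. by rewrite /star !mulgA mulgV mul1g mulgVK. Qed.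

(** As [a * star a b * b] is [circ a b], this is the associativity of [circ]
    on [(a, b, c)]. *)
Lemma star_circl (A : skewBraceType) (a b c : A) :
  star (a * star a b * b) c = star a (star b c) * star b c * star a c.
Proof.
rewrite -circE {1}/star -circA (circE b c) -mulgA 2!circ_mulr.
by move: (star b c) => s; rewrite /star !mulgA mulVg mul1g mulgVK.
Qed.

(** Normality for [circ] holds because the [circ]-conjugate of [x] by [g] is
    a conjugate in [A] of [y * star y (circ_inv g)], where [y = lambda g x]. *)
Lemma ideal_star (A : twoSidedSkewBraceType) (I : set A) :
  normal_subgroup (dot_group A) I -> (forall a x, I x -> I (star a x)) ->
  (forall a x, I x -> I (star x a)) -> ideal I.
Proof.
move=> nI starI Istar; have [[_ gI] /= conjI] := nI.
have IM x y : I x -> I y -> I (x * y) := gopS gI (x := x) (y := y).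
have IV x : I x -> I x^-1 := ginvS gI (x := x).
have lamI a x : I x -> I (lambda a x).
  move=> Ix; rewrite /lambda circE !mulgA mulVg mul1g.
  by apply: IM => //; exact: starI.
split=> //; split.
  split=> //; split=> /=.
  - move=> x y Ix Iy; rewrite circE; apply: (IM _ _ _ Iy).
    by apply: (IM _ _ Ix); exact: starI.
  - exact: (goneS gI).
  - move=> x Ix; rewrite -[circ_inv x]invgK; apply/IV.
    have -> : (circ_inv x)^-1 = x * star x (circ_inv x).
      apply/invg_inj; rewrite invgK; apply/esym/mulg1_eq.
      by rewrite -circE circgV.
    by apply: IM => //; exact: Istar.
  - by move=> *; exact: circA.
  - by move=> *; exact: circ1g.
  - by move=> *; exact: circg1.
  - by move=> *; exact: circVg.
  - by move=> *; exact: circgV.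
move=> g x _ /(lamI g) /=.
have -> : circ g x = g * lambda g x by rewrite /lambda !mulgA mulgV mul1g.
move: (lambda g x) => y Iy; rewrite circ_mull circgV mul1g circE mulgA.
rewrite -[X in I (_ * X)]invgK; apply: conjI => //.
by apply: IM => //; exact: Istar.
Qed.

(** * The ideals P_n and their images in the abelianization *)

Section Powers.
Variable A : twoSidedSkewBraceType.
Hypothesis starA : associative (@star A).
Implicit Types (a b c x y z : A) (n m : nat) (s : seq A).

Let starMrJ a b c : star a (b * c) = star a b * star a c ^ b^-1.
Proof. by rewrite starMr conjgE invgK !mulgA. Qed.

Let starMlJ a b c : star (a * b) c = star a c ^ b * star b c.
Proof. by rewrite starMl conjgE !mulgA. Qed.

Let starDr a b c : star a (b * c) = star a b * star a c.
Proof. exact: (star_mulr starMrJ starMlJ starA (@star_circl A)). Qed.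

Let starDl a b c : star (a * b) c = star a c * star b c.
Proof. exact: (star_mull starMrJ starMlJ starA (@star_circl A)). Qed.

Let starNr a b : star a b^-1 = (star a b)^-1.
Proof. exact: (starVr starMrJ starMlJ starA (@star_circl A)). Qed.

Let starNl a b : star a^-1 b = (star a b)^-1.
Proof. exact: (starVl starMrJ starMlJ starA (@star_circl A)). Qed.

Let star0l a : star 1 a = 1.
Proof. exact: star1g starMlJ a. Qed.

Let star0r a : star a 1 = 1.
Proof. exact: starg1 starMrJ a. Qed.

Let starC a b c : commute (star a b) c.
Proof. exact: (star_central starMrJ starMlJ starA (@star_circl A)). Qed.

Let starD a x : derived x -> star a x = 1 /\ star x a = 1.
Proof. exact: (star_derived starMrJ starMlJ starA (@star_circl A)). Qed.

Lemma PE m :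
  P A m.+2 = generated (dot_group A) (nfold_products (@star A) m.+2).
Proof. by []. Qed.

Lemma P_subgroup n : subgroup (dot_group A) (P A n).
Proof.
rewrite /P; case: ifP => _; first by apply: subgroup_dotP.
by apply: generated_subgroup => //; exact: is_group_dot.
Qed.

Lemma P_central n x y : (2 <= n)%N -> P A n x -> commute x y.
Proof.
case: n => [|[|m]] // _; rewrite PE => Px; move: x Px.
apply: (@smallest_sub _ _ _ [set x | commute x y]).
  apply: subgroup_dotP => /= [|u v uy vy|u uy]; apply/commute_sym.
  - exact: commute1.
  - by apply: commuteM; exact/commute_sym.
  - exact/commuteV/commute_sym.
move=> _ /nfold_seqP [a [b [s [_ ->]]]] /=; rewrite foldl_rcons.
exact: starC.
Qed.

(** A factor multiplied on the left is absorbed by the first factor, so the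
    number of factors does not change. *)
Lemma star_foldl a b s :
  star a (foldl (@star A) b s) = foldl (@star A) (star a b) s.
Proof. by elim: s a b => //= c s IH a b; rewrite IH starA. Qed.

Lemma P_starl n a x : P A n x -> P A n (star a x).
Proof.
case: n => [|[|m]] //; rewrite {1}PE => Px; move: x Px.
have [_ gP] := P_subgroup m.+2.
apply: (@smallest_sub _ _ _ [set x | P A m.+2 (star a x)]).
  apply: subgroup_dotP => /= [|u v|u]; rewrite ?star0r ?starDr ?starNr.
  - exact: (goneS gP).
  - exact: (gopS gP).
  - exact: (ginvS gP).
move=> _ /nfold_seqP [b [c [s [sm ->]]]] /=; rewrite PE.
apply: sub_gen_smallest.
by apply/nfold_seqP; exists (star a b), c, s; rewrite star_foldl.
Qed.

Lemma P_starr n a x : P A n x -> P A n (star x a).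
Proof.
case: n => [|[|m]] //; rewrite {1}PE => Px; move: x Px.
have [_ gP] := P_subgroup m.+2.
apply: (@smallest_sub _ _ _ [set x | P A m.+2 (star x a)]).
  apply: subgroup_dotP => /= [|u v|u]; rewrite ?star0l ?starDl ?starNl.
  - exact: (goneS gP).
  - exact: (gopS gP).
  - exact: (ginvS gP).
move=> _ /nfold_seqP [b [c [s [sm ->]]]] /=; rewrite PE.
apply: sub_gen_smallest.
by apply/nfold_seqP; exists b, (star c a), s; rewrite !foldl_rcons starA.
Qed.

Lemma P_ideal n : ideal (P A n).
Proof.
apply: ideal_star => [|a x|a x]; [|exact: P_starl|exact: P_starr].
split=> [|g x _]; first exact: P_subgroup.
have [n2|n1] := leqP 2 n; last by move=> _; rewrite /P -ltnS n1.
by move=> Px; rewrite /= -(P_central g n2 Px) mulgK.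
Qed.

Lemma central_star_ring (H : set A) :
  subgroup (dot_group A) H -> (forall x y, H x -> commute x y) ->
  (forall x y, H x -> H y -> H (star x y)) -> is_ring (sub_ring (dot_star A) H).
Proof.
move=> [_ gH] HC HM; split=> // [x y Hx _|x y z _ _ _|x y z _ _ _|x y z _ _ _].
- exact: HC.
- exact: starA.
- exact: starDl.
- exact: starDr.
Qed.

(** [star x (circ_inv x)] is [x^-1 * (circ_inv x)^-1], so commutativity makes
    [circ_inv x] the quasi-inverse of [x]. *)
Lemma P_radical_ring n :
  (2 <= n)%N -> is_radical_ring (sub_ring (dot_star A) (P A n)).
Proof.
move=> n2; split.
  apply: central_star_ring => [|x y Px|x y _]; first exact: P_subgroup.
    exact: P_central Px.
  exact: P_starl.
move=> x /= Px; have [_ [[_ gP] _] _] := P_ideal n.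
exists (circ_inv x); first exact: (ginvS gP Px).
by rewrite /star circgV mulg1 -invgM /= (P_central _ n2 Px) mulgV.
Qed.

Lemma pi_foldl a s :
  pi_ab (foldl (@star A) a s) = foldl (@quo_mul A) (pi_ab a) (map (@pi_ab A) s).
Proof. by elim: s a => //= b s IH a; rewrite IH quo_mul_pi. Qed.

Lemma quo_power_subgroup n :
  subgroup (add_group (abelianization A)) (quo_power A n).
Proof.
rewrite /quo_power; case: ifP => _; first by apply: subgroup_addP.
by apply: generated_subgroup => //; exact: is_group_add.
Qed.

Lemma pi_P n x : P A n x -> quo_power A n (pi_ab x).
Proof.
case: n => [|[|m]] //; rewrite {1}PE => Px; move: x Px.
have [_ gR] := quo_power_subgroup m.+2.
apply: (@smallest_sub _ _ _ [set x | quo_power A m.+2 (pi_ab x)]).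
  apply: subgroup_dotP => /= [|u v|u]; rewrite ?pi_abM ?pi_abV.
  - exact: (goneS gR).
  - exact: (gopS gR).
  - exact: (ginvS gR).
move=> _ /nfold_seqP [b [c [s [sm ->]]]] /=; apply: sub_gen_smallest.
apply/nfold_seqP; exists (pi_ab b), (pi_ab c), (map (@pi_ab A) s).
by rewrite size_map pi_foldl map_rcons.
Qed.

Lemma pi_P_surj n u : quo_power A n u -> exists2 x, P A n x & pi_ab x = u.
Proof.
case: n => [|[|m]]; [| |move=> Ru; move: u Ru].
- by move=> _; have [x <-] := pi_ab_surj u; exists x.
- by move=> _; have [x <-] := pi_ab_surj u; exists x.
have [_ gP] := P_subgroup m.+2.
apply: (@smallest_sub _ _ _ [set u | exists2 x, P A m.+2 x & pi_ab x = u]).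
  apply: subgroup_addP => /= [|_ _ [x Px <-] [y Py <-]|_ [x Px <-]].
  - by exists 1 => //; exact: (goneS gP).
  - by exists (x * y); [exact: (gopS gP) | rewrite pi_abM].
  - by exists x^-1; [exact: (ginvS gP) | rewrite pi_abV].
move=> _ /nfold_seqP [u [v [t [tm ->]]]] /=.
exists (foldl (@star A) (repr u) (map repr (rcons t v))).
  apply: sub_gen_smallest; apply/nfold_seqP.
  exists (repr u), (repr v), (map repr t).
  by rewrite size_map map_rcons.
have piK : cancel repr (@pi_ab A) := @reprK _ _.
by rewrite pi_foldl piK (mapK piK).
Qed.

Lemma derived_subgroup : subgroup (dot_group A) (@derived A).
Proof. by apply: generated_subgroup => //; exact: is_group_dot. Qed.

Lemma P_short_exact n :
  group_short_exact
    (sub_group (dot_group A) (P A n `&` @derived A))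
    (sub_group (dot_group A) (P A n))
    (sub_group (add_group (abelianization A)) (quo_power A n))
    id (@pi_ab A).
Proof.
split=> /=.
- split; [|exact: (P_subgroup n).2|exact: (quo_power_subgroup n).2].
  exact: (subgroupI (P_subgroup n) derived_subgroup).2.
- split; split=> //= x; first by case.
    exact: pi_P.
  by move=> y _ _; exact: pi_abM.
- by [].
- rewrite image_id; apply/seteqP; split=> x [Px /= Dx]; split=> //=.
    by apply/esym/pi_abP; rewrite invg1 mul1g.
  by move: (esym Dx) => /pi_abP; rewrite invg1 mul1g.
- by move=> u /= /pi_P_surj [x Px <-]; exists x.
Qed.

Lemma P_short_exact_ring n : (2 <= n)%N ->
  ring_short_exact
    (sub_ring (dot_star A) (P A n `&` @derived A))
    (sub_ring (dot_star A) (P A n))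
    (sub_ring (quo_ring A) (quo_power A n))
    id (@pi_ab A).
Proof.
move=> n2; have exactP := P_short_exact n; split=> //; last first.
  have [_ [homi homp] _ _ _] := exactP.
  by split; split=> //= x y _ _; rewrite quo_mul_pi.
split; last first.
- have [ringR _] := quo_ring_radical starA.
  apply: (is_subring ringR) => [|u v]; first exact: quo_power_subgroup.
  move=> /pi_P_surj [x Px <-] /pi_P_surj [y Py <-] /=.
  by rewrite quo_mul_pi; apply/pi_P/P_starl.
- by case: (P_radical_ring n2).
apply: central_star_ring => [|x y [Px _]|x y [Px Dx] [Py Dy]].
- exact: subgroupI (P_subgroup n) derived_subgroup.
- exact: P_central Px.
- have [-> _] := starD x Dy; split; last exact: derived1.
  exact: (goneS (P_subgroup n).2).
Qed.

Lemma P_derived_annihilated n a x :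
  (P A n `&` @derived A) x -> star a x = 1 /\ star x a = 1.
Proof. by case=> _; exact: starD. Qed.

End Powers.

Theorem proposition4p7 (A : twoSidedSkewBraceType)
    (starA : associative (@star A)) (n : nat) (n_ge1 : (1 <= n)%N) :
  [/\ group_short_exact
        (sub_group (dot_group A) (P A n `&` @derived A))
        (sub_group (dot_group A) (P A n))
        (sub_group (add_group (abelianization A)) (quo_power A n))
        id (@pi_ab A),
      ideal (P A n),
      (2 <= n)%N ->
        is_radical_ring (sub_ring (dot_star A) (P A n)) /\
        ring_short_exact
          (sub_ring (dot_star A) (P A n `&` @derived A))
          (sub_ring (dot_star A) (P A n))
          (sub_ring (quo_ring A) (quo_power A n))
          id (@pi_ab A),
      forall a x, (P A n `&` @derived A) x -> star a x = 1 /\ star x a = 1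
    & forall x y, (P A n `&` @derived A) x -> (P A n `&` @derived A) y ->
        star x y = 1].
Proof.
split.
- exact: P_short_exact.
- exact: P_ideal.
- by move=> n2; split; [exact: P_radical_ring | exact: P_short_exact_ring].
- by move=> a x; exact: P_derived_annihilated.
- by move=> x y Kx /(P_derived_annihilated starA x) [].
Qed.
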